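(* Let $(X;\sim,\backsim,\wedge,1)$ be a pseudo equality algebra. Then there is a one-to-one correspondence (bijection) between the set $NCDS(X)$ of all normal closed deductive systems of $X$ and the set $Con(X)$ of all congruence relations on $X$.
   Context: A pseudo equality algebra is an algebra $(X;\sim,\backsim,\wedge,1)$ of type $(2,2,2,0)$ such that for all $a,b,c\in X$ (with $x\le y$ iff $x\wedge y=x$): (F1) $(X;\wedge,1)$ is a meet-semilattice with top element $1$; (F2) $a\sim a=1=a\backsim a$; (F3) $a\sim 1=a=1\backsim a$; (F4) $a\leq b\leq c$ implies $a\sim c\leq b\sim c$, $a\sim c\leq a\sim b$, $c\backsim a\leq c\backsim b$ and $c\backsim a\leq b\backsim a$; (F5) $a\sim b\leq (a\wedge c)\sim (b\wedge c)$ and $a\backsim b\leq (a\wedge c)\backsim (b\wedge c)$; (F6) $a\sim b\leq (c\sim a)\backsim (c\sim b)$ and $a\backsim b\leq (a\backsim c)\sim (b\backsim c)$; (F7) $a\sim b\leq (a\sim c)\sim (b\sim c)$ and $a\backsim b\leq (c\backsim a)\backsim (c\backsim b)$. A deductive system of $X$ is a subset $F\subseteq X$ with $1\in F$ such that $F$ is an upset ($a\in F$, $a\le b\in X$ imply $b\in F$) and $a,\,b\sim a\in F$ imply $b\in F$ for all $a,b\in X$. It is closed if $x\sim y,\ x\backsim y\in F$ for all $x,y\in F$. It is normal if for all $x,y\in X$: $x\sim y,\,y\sim x\in F$ if and only if $y\backsim x,\,x\backsim y\in F$. A congruence relation on $X$ is an equivalence relation $\theta$ on $X$ such that $(a*x,b*y)\in\theta$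 for all $*\in\{\sim,\backsim,\wedge\}$ and all $(a,b),(x,y)\in\theta$. *)

(* Defs.v *)
From HB Require Import structures.
From Stdlib Require Import RelationClasses.
From mathcomp Require Import all_boot all_order.
From mathcomp Require Import boolp classical_sets functions.

Set Implicit Arguments.
Unset Strict Implicit.
Unset Printing Implicit Defensive.

Import Order.TTheory.
Local Open Scope order_scope.

Reserved Notation "a \sim b" (at level 45, no associativity).
Reserved Notation "a \bsim b" (at level 45, no associativity).

(* The meet-semilattice with top element is [tMeetSemilatticeType], whose order
   satisfies [x <= y] iff [x `&` y = x] ([leEmeet]).  Its underlying
   [choiceType] structure is no restriction classically: every type has one
   ([boolp.gen_eqMixin], [boolp.gen_choiceMixin]). *)
HB.mixin Record isPseudoEquality d X of Order.TMeetSemilattice d X := {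
  sim : X -> X -> X;
  bsim : X -> X -> X;
  simxx : forall a : X, sim a a = \top;
  bsimxx : forall a : X, bsim a a = \top;
  simx1 : forall a : X, sim a \top = a;
  bsim1x : forall a : X, bsim \top a = a;
  sim_monol : forall a b c : X, a <= b -> b <= c -> sim a c <= sim b c;
  sim_antir : forall a b c : X, a <= b -> b <= c -> sim a c <= sim a b;
  bsim_monor : forall a b c : X, a <= b -> b <= c -> bsim c a <= bsim c b;
  bsim_antil : forall a b c : X, a <= b -> b <= c -> bsim c a <= bsim b a;
  sim_meet : forall a b c : X, sim a b <= sim (a `&` c) (b `&` c);
  bsim_meet : forall a b c : X, bsim a b <= bsim (a `&` c) (b `&` c);
  sim_bsim : forall a b c : X, sim a b <= bsim (sim c a) (sim c b);
  bsim_sim : forall a b c : X, bsim a b <= sim (bsim a c) (bsim b c);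
  sim_sim : forall a b c : X, sim a b <= sim (sim a c) (sim b c);
  bsim_bsim : forall a b c : X, bsim a b <= bsim (bsim c a) (bsim c b);
}.

#[short(type="pseudoEqualityType")]
HB.structure Definition PseudoEquality d :=
  { X of Order.TMeetSemilattice d X & isPseudoEquality d X }.

Notation "a \sim b" := (sim a b) : order_scope.
Notation "a \bsim b" := (bsim a b) : order_scope.

Section DeductiveSystems.
Context {d : Order.disp_t} {X : pseudoEqualityType d}.
Implicit Types (F : set X) (a b x y : X).

Definition deductive_system F : Prop :=
  [/\ F \top,
      forall a b, F a -> a <= b -> F b
    & forall a b, F a -> F (b \sim a) -> F b].

Definition closed_ds F : Prop :=
  forall x y, F x -> F y -> F (x \sim y) /\ F (x \bsim y).

Definition normal_ds F : Prop :=
  forall x y, (F (x \sim y) /\ F (y \sim x)) <->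
              (F (y \bsim x) /\ F (x \bsim y)).

Record congruence (theta : X -> X -> Prop) : Prop := Congruence {
  congruence_equiv : Equivalence theta;
  congruence_sim : forall a b x y,
    theta a b -> theta x y -> theta (a \sim x) (b \sim y);
  congruence_bsim : forall a b x y,
    theta a b -> theta x y -> theta (a \bsim x) (b \bsim y);
  congruence_meet : forall a b x y,
    theta a b -> theta x y -> theta (a `&` x) (b `&` y)
}.

End DeductiveSystems.

Local Open Scope classical_set_scope.

Definition NCDS d (X : pseudoEqualityType d) : set (set X) :=
  [set F | [/\ deductive_system F, closed_ds F & normal_ds F]].

Definition Con d (X : pseudoEqualityType d) : set (X -> X -> Prop) :=
  [set theta | congruence theta].

Arguments NCDS {d} X.
Arguments Con {d} X.

(* Main.v *)
Require Import Defs.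
From mathcomp Require Import all_boot all_order.
From mathcomp Require Import boolp classical_sets functions.
From Stdlib Require Import RelationClasses.

(** As for filters in residuated structures, a deductive system F is sent to
    the relation x \sim y, y \sim x \in F, and a congruence theta to the class
    of 1.

    Axioms (F5)-(F7) bound a \sim b and a \bsim b from above by the comparison
    of the images of a and b under each unary translation (meet with c, or
    either operation with one argument c). As F is an upset, comparisons that
    lie in F are therefore inherited by the images. Some of these come out in
    terms of the other operation, and normality of F converts them back
    ([ds_rel_congruence]). Closedness makes the class of 1 as large as F: x is
    related to 1 iff both x \sim 1 = x and 1 \sim x lie in F
    ([top_class_ds_rel]).

    Going back from theta, the point is that if x \sim y and y \sim x are
    congruent to 1, then so are x and y to each other. This follows from the
    residuation-like inequality y <= (x \sim y) \bsim x, an instance of (F6)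
    ([le_sim_bsim]): modulo theta its right-hand side becomes 1 \bsim x = x, so
    y lies below x modulo theta, and by symmetry the two agree. The mirror
    inequality ([le_bsim_sim]) gives the same for \bsim. So either of the two
    symmetric conditions is equivalent to theta x y ([congruence_simP],
    [congruence_bsimP]); this yields at once the normality of the class of 1
    and the fact that theta is recovered from it. *)

Set Implicit Arguments.
Unset Strict Implicit.
Unset Printing Implicit Defensive.

Import Order.TTheory.
Local Open Scope order_scope.

Section Correspondence.
Context {d : Order.disp_t} {X : pseudoEqualityType d}.
Implicit Types (F : set X) (theta : X -> X -> Prop) (a b c x y z : X).

Definition ds_rel F x y : Prop := F (x \sim y) /\ F (y \sim x).

Definition top_class theta : set X := [set x | theta x \top]%classic.

(** Instance b = 1 of (F6), since c \sim 1 = c. *)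
Lemma le_sim_bsim a c : a <= (c \sim a) \bsim c.
Proof. by have := sim_bsim a \top c; rewrite !simx1. Qed.

(** Instance of the other half of (F6), since 1 \bsim c = c. *)
Lemma le_bsim_sim a c : a <= c \sim (a \bsim c).
Proof. by have := bsim_sim \top a c; rewrite !bsim1x. Qed.

Lemma ds_rel_trans F x y z :
  deductive_system F -> ds_rel F x y -> ds_rel F y z -> ds_rel F x z.
Proof.
move=> [_ upF mpF] [xy yx] [yz zy]; split.
- by apply: mpF yz _; apply: upF xy (sim_sim _ _ _).
- by apply: mpF yx _; apply: upF zy (sim_sim _ _ _).
Qed.

(** Two-sided compatibility is reduced to compatibility in each argument by
    transitivity.  Normality is what lets the same relation be tested with either
    operation, as (F6) exchanges the two while (F7) preserves each of them. *)
Lemma ds_rel_congruence F :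
  deductive_system F -> normal_ds F -> congruence (ds_rel F).
Proof.
move=> dsF nF; have [F1 upF _] := dsF.
have toB x y : ds_rel F x y -> F (x \bsim y) /\ F (y \bsim x).
  by case/nF.
have ofB x y : F (x \bsim y) -> F (y \bsim x) -> ds_rel F x y.
  by move=> xy yx; apply/nF.
split.
- split.
  + by move=> x; split; rewrite simxx.
  + by move=> x y [].
  + by move=> x y z; apply: ds_rel_trans.
- move=> a b x y [ab ba] [xy yx]; apply: (@ds_rel_trans F _ (b \sim x)) => //.
  + by split; [apply: upF ab (sim_sim _ _ _) | apply: upF ba (sim_sim _ _ _)].
  + by apply: ofB; [apply: upF xy (sim_bsim _ _ _)
                   | apply: upF yx (sim_bsim _ _ _)].
- move=> a b x y /toB[ab ba] /toB[xy yx].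
  apply: (@ds_rel_trans F _ (b \bsim x)) => //.
  + by split; [apply: upF ab (bsim_sim _ _ _) | apply: upF ba (bsim_sim _ _ _)].
  + by apply: ofB; [apply: upF xy (bsim_bsim _ _ _)
                   | apply: upF yx (bsim_bsim _ _ _)].
- move=> a b x y [ab ba] [xy yx]; apply: (@ds_rel_trans F _ (b `&` x)) => //.
  + by split; [apply: upF ab (sim_meet _ _ _) | apply: upF ba (sim_meet _ _ _)].
  + rewrite ![b `&` _]meetC.
    by split; [apply: upF xy (sim_meet _ _ _) | apply: upF yx (sim_meet _ _ _)].
Qed.

Lemma top_class_ds_rel F :
  deductive_system F -> closed_ds F -> top_class (ds_rel F) = F.
Proof.
move=> [F1 _ _] cF; apply/seteqP; split=> x /=; first by case; rewrite simx1.
by move=> Fx; split; [rewrite simx1 | apply: (cF \top x F1 Fx).1].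
Qed.

Section Congruence.
Context (theta : X -> X -> Prop) (ctheta : congruence theta).

Let theta_refl x : theta x x.
Proof. exact: (@Equivalence_Reflexive _ _ (congruence_equiv ctheta)). Qed.
Let theta_sym x y : theta x y -> theta y x.
Proof. exact: (@Equivalence_Symmetric _ _ (congruence_equiv ctheta)). Qed.
Let theta_trans x y z : theta x y -> theta y z -> theta x z.
Proof. exact: (@Equivalence_Transitive _ _ (congruence_equiv ctheta)). Qed.

Lemma congruence_le_meet x y z : y <= z -> theta z x -> theta y (y `&` x).
Proof.
move=> /meet_idPl {1}<- zx.
exact: (congruence_meet ctheta (theta_refl y) zx).
Qed.

Lemma congruence_meet_anti x y :
  theta y (y `&` x) -> theta x (x `&` y) -> theta x y.
Proof.
by move=> yx xy; apply: theta_trans xy _; rewrite meetC; apply: theta_sym.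
Qed.

Lemma congruence_sim_top x y : theta (x \sim y) \top -> theta y (y `&` x).
Proof.
move=> xy; apply: congruence_le_meet (le_sim_bsim y x) _.
by have := congruence_bsim ctheta xy (theta_refl x); rewrite bsim1x.
Qed.

Lemma congruence_bsim_top x y : theta (y \bsim x) \top -> theta y (y `&` x).
Proof.
move=> yx; apply: congruence_le_meet (le_bsim_sim y x) _.
by have := congruence_sim ctheta (theta_refl x) yx; rewrite simx1.
Qed.

Lemma congruence_simP x y :
  theta x y <-> theta (x \sim y) \top /\ theta (y \sim x) \top.
Proof.
split=> [xy | [xy yx]].
  have tyy := theta_refl y; split.
  - by have := congruence_sim ctheta xy tyy; rewrite simxx.
  - by have := congruence_sim ctheta tyy xy; rewrite simxx.
by apply: congruence_meet_anti; apply: congruence_sim_top.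
Qed.

Lemma congruence_bsimP x y :
  theta x y <-> theta (y \bsim x) \top /\ theta (x \bsim y) \top.
Proof.
split=> [xy | [yx xy]].
  have tyy := theta_refl y; split.
  - by have := congruence_bsim ctheta tyy xy; rewrite bsimxx.
  - by have := congruence_bsim ctheta xy tyy; rewrite bsimxx.
by apply: congruence_meet_anti; apply: congruence_bsim_top.
Qed.

Lemma ds_rel_top_class : ds_rel (top_class theta) = theta.
Proof.
by apply/funext => x; apply/funext => y; apply/propext; rewrite congruence_simP.
Qed.

Lemma top_class_NCDS : NCDS X (top_class theta).
Proof.
split.
- split=> [|a b a1 ab|a b a1 ba1] /=; first exact: theta_refl.
  + have := congruence_meet ctheta a1 (theta_refl b).
    by rewrite (meet_idPl ab) meet1x => /theta_sym /theta_trans; apply.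
  + have := congruence_sim ctheta (theta_refl b) a1.
    by rewrite simx1 => /theta_sym /theta_trans; apply.
- move=> x y x1 y1; split.
  + by have := congruence_sim ctheta x1 y1; rewrite simxx.
  + by have := congruence_bsim ctheta x1 y1; rewrite bsimxx.
- by move=> x y; rewrite -congruence_simP; apply: congruence_bsimP.
Qed.

End Congruence.

End Correspondence.

Theorem theorem4p10 (d : Order.disp_t) (X : pseudoEqualityType d) :
  exists f : set X -> (X -> X -> Prop), set_bij (NCDS X) (Con X) f.
Proof.
exists ds_rel; split.
- by move=> F [dsF _ nF]; apply: ds_rel_congruence.
- move=> F G /set_mem[dsF cF _] /set_mem[dsG cG _] eqFG.
  by rewrite -(top_class_ds_rel dsF cF) eqFG top_class_ds_rel.
- move=> theta ctheta; exists (top_class theta).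
  + exact: top_class_NCDS.
  + exact: ds_rel_top_class.
Qed.
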